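(* Let $a=(\alpha,\vdash)$ and $a'=(\alpha',\vdash')$ be algebraizable logics and let $h\in\mathcal{A}_f(a,a')$. Then the induced functor $h^\star:\alpha'\text{-Str}\to\alpha\text{-Str}$ restricts to a functor $h^\star\!\upharpoonright:QV(a')\to QV(a)$, i.e. $I\circ h^\star\!\upharpoonright=h^\star\circ I'$, where $I:QV(a)\hookrightarrow\alpha\text{-Str}$ and $I':QV(a')\hookrightarrow\alpha'\text{-Str}$ are the inclusion functors.
   Context: A signature is a sequence $\Sigma=(\Sigma_n)_{n\in\mathbb{N}}$ of pairwise disjoint sets. $X=\{x_0,x_1,\dots\}$ is a fixed enumerable set of variables; $F(\Sigma)$ is the set of $\Sigma$-formulas over $X$, and $F(\Sigma)[n]$ the set of those whose variables are exactly $x_0,\dots,x_{n-1}$. A flexible morphism $h:\Sigma\to\Sigma'$ is a sequence of functions $h_n:\Sigma_n\to F(\Sigma')[n]$; its extension $\check h:F(\Sigma)\to F(\Sigma')$ is given by $\check h(x)=x$ and $\check h(c_n(\psi_0,\dots,\psi_{n-1}))=h(c_n)[x_0|\check h(\psi_0),\dots,x_{n-1}|\check h(\psi_{n-1})]$. $\Sigma\text{-Str}$ is the category of all $\Sigma$-structures (algebras) and homomorphisms. For a flexible morphism $h:\Sigma\to\Sigma'$, $h^\star:\Sigma'\text{-Str}\to\Sigma\text{-Str}$ sends $M'$ to the $\Sigma$-structure on the same set interpreting $c_n$ as the term operation $h(c_n)^{M'}$, and is the identity on underlying functions. A logic is $l=(\Sigma,\vdash)$ with $\vdash\subseteq\wp(F(\Sigma))\times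 F(\Sigma)$ a Tarskian consequence relation: reflexive, monotone, satisfying cut, finitary and structural. An $\mathcal{L}_f$-morphism $h:(\Sigma,\vdash)\to(\Sigma',\vdash')$ is a flexible morphism with $\Gamma\vdash\psi\Rightarrow\check h[\Gamma]\vdash'\check h(\psi)$. A quasivariety is a class of algebras axiomatized by quasi-identities, viewed as a full subcategory of $\Sigma\text{-Str}$. For a class $K$ of $\Sigma$-algebras, $\Gamma\models_K\varphi\equiv\psi$ means that every homomorphism $F(\Sigma)\to A\in K$ identifying both sides of each equation in $\Gamma$ identifies $\varphi,\psi$. $K$ is an equivalent algebraic semantics for $(\Sigma,\vdash)$ if there are a finite set $\tau(p)$ of equations $\delta(p)\equiv\varepsilon(p)$ in one variable and a finite set $\Delta(p,q)$ of formulas in two variables such that $\Gamma\vdash\varphi\Leftrightarrow\{\tau(\gamma):\gamma\in\Gamma\}\models_K\tau(\varphi)$ and $\varphi\equiv\psi$ is $\models_K$-interderivable with $\tau(\varphi\Delta\psi)$, where $\varphi\Delta\psi:=\Delta(\varphi,\psi)$. Then the logic is algebraizable (Blok–Pigozzi) with algebraizing pair $\langle(\delta,\varepsilon),\Delta\rangle$. $QV(a)$ is the unique quasivariety that is an equivalent algebraic semantics of the algebraizable logic $a$. $\mathcal{A}_f$ is the category with objects the algebraizable logics and arrows the $\mathcal{L}_f$-morphisms $h:a\to a'$ preserving algebraizing pairs (if $\langle(\delta,\varepsilon),\Delta\rangle$ is one for $a$ then $\langle(\check h(\delta),\check h(\varepsilon)),\check h(\Delta)\rangle$ is one for $a'$).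 *)

(* Defs.v *)
From Stdlib Require Import ClassicalEpsilon.
From mathcomp Require Import all_boot.
From mathcomp Require Import boolp classical_sets functions cardinality.

Set Implicit Arguments.
Unset Strict Implicit.
Unset Printing Implicit Defensive.

Local Open Scope classical_set_scope.

(** * Categories and functors *)

Record category := Category {
  obj :> Type;
  arrow : obj -> obj -> Type;
  idm : forall A, arrow A A;
  comp : forall A B C, arrow B C -> arrow A B -> arrow A C;
  compA : forall A B C D (h : arrow C D) (g : arrow B C) (f : arrow A B),
    comp h (comp g f) = comp (comp h g) f;
  comp1m : forall A B (f : arrow A B), comp (idm B) f = f;
  compm1 : forall A B (f : arrow A B), comp f (idm A) = f }.

Record functor (C D : category) := Functor {
  fobj :> C -> D;
  fmap : forall A B : C, arrow A B -> arrow (fobj A) (fobj B);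
  fmap_id : forall A : C, fmap (idm A) = idm (fobj A);
  fmap_comp : forall (A B E : C) (g : arrow B E) (f : arrow A B),
    fmap (comp g f) = comp (fmap g) (fmap f) }.

Definition functor_comp (C D E : category) (G : functor D E) (F : functor C D)
  : functor C E.
Proof.
refine (@Functor C E (fun A => G (F A)) (fun A B f => fmap G (fmap F f)) _ _).
- by move=> A; rewrite !fmap_id.
- by move=> A B B' g f; rewrite !fmap_comp.
Defined.

Definition full_subcategory (C : category) (P : C -> Prop) : category :=
  @Category {A : C | P A} (fun A B => arrow (sval A) (sval B))
    (fun A => idm (sval A)) (fun A B D g f => comp g f)
    (fun A B D E h g f => compA h g f)
    (fun A B f => comp1m f) (fun A B f => compm1 f).

Definition inclusion (C : category) (P : C -> Prop)
  : functor (full_subcategory P) C :=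
  @Functor (full_subcategory P) C (fun A => sval A) (fun A B f => f)
    (fun A => erefl) (fun A B D g f => erefl).

(** * Signatures, formulas and structures *)

(* Disjointness of the sets [S n] is automatic: a connective occurs in a
   formula together with its arity. *)
Definition signature := nat -> Type.

Inductive formula (S : signature) : Type :=
| Var of nat
| App n of S n & ('I_n -> formula S).
Arguments Var {S} _.
Arguments App {S n} _ _.

Fixpoint occurs (S : signature) (i : nat) (phi : formula S) : Prop :=
  match phi with
  | Var j => i = j
  | App n c args => exists k, occurs i (args k)
  end.

Definition vars (S : signature) (phi : formula S) : set nat :=
  [set i | occurs i phi].

Record formula_in (S : signature) (n : nat) := FormulaIn {
  fval :> formula S;
  fvalP : vars fval = [set i | i < n] }.

(* The carrier may be empty when the signature has no constants. *)
Record structure (S : signature) := Structure {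
  carrier :> Type;
  op : forall n, S n -> ('I_n -> carrier) -> carrier }.

(* Not [set (structure S)], for universe reasons: the carriers must be able to
   accommodate formulas, whose type mentions ['I_n]. *)
Definition class (S : signature) := structure S -> Prop.

Record homo (S : signature) (M N : structure S) := Homo {
  hfun :> M -> N;
  homoP : forall n (c : S n) (args : 'I_n -> M),
    hfun (op c args) = op c (fun k => hfun (args k)) }.

Lemma homo_eq (S : signature) (M N : structure S) (f g : homo M N) :
  hfun f = hfun g -> f = g.
Proof.
by case: f g => [f Pf] [g Pg] /= E; subst g; congr Homo; exact: Prop_irrelevance.
Qed.

Definition homo_id (S : signature) (M : structure S) : homo M M :=
  @Homo S M M (fun x => x) (fun n c args => erefl).

Definition homo_comp (S : signature) (M N P : structure S)
  (g : homo N P) (f : homo M N) : homo M P.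
Proof.
refine (@Homo S M P (fun x => g (f x)) _).
by move=> n c args; rewrite !homoP.
Defined.

Definition Str (S : signature) : category.
Proof.
refine (@Category (structure S) (@homo S) (@homo_id S) (@homo_comp S) _ _ _).
- by move=> *; exact: homo_eq.
- by move=> *; exact: homo_eq.
- by move=> *; exact: homo_eq.
Defined.

(* The value of [phi] in [M].  Only the variables of [phi] need a value, so
   that closed formulas, for instance, can be evaluated without assuming that
   [M] is nonempty. *)
Fixpoint eval (S : signature) (M : structure S) (phi : formula S)
  : (forall i, occurs i phi -> M) -> M :=
  match phi with
  | Var j => fun v => v j erefl
  | App n c args => fun v =>
      op c (fun k => @eval S M (args k)
                       (fun i oi => v i (ex_intro (fun k => occurs i (args k)) k oi)))
  end.

Definition eval_total (S : signature) (M : structure S) (v : nat -> M)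
  (phi : formula S) : M := @eval S M phi (fun i _ => v i).

Lemma formula_in_lt (S : signature) n (phi : formula_in S n) i :
  occurs i phi -> i < n.
Proof. by move=> oi; have : vars phi i by []; rewrite fvalP. Qed.

(* The term operation [phi^M], mapping m_0, ..., m_(n-1) to the value of [phi]
   when each x_i is given the value m_i. *)
Definition term_op (S : signature) (M : structure S) n (phi : formula_in S n)
  (m : 'I_n -> M) : M :=
  @eval S M phi (fun i oi => m (Ordinal (formula_in_lt oi))).

(* The absolutely free algebra F(S).  Evaluating a formula in it amounts to
   simultaneously substituting formulas for its variables. *)
Definition free (S : signature) : structure S :=
  @Structure S (formula S) (fun n c args => App c args).

Definition subst (S : signature) (sigma : nat -> formula S) (phi : formula S)
  : formula S := @eval_total S (free S) sigma phi.

(** * Flexible morphisms *)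

Definition flexible (S S' : signature) := forall n, S n -> formula_in S' n.

Fixpoint ext (S S' : signature) (h : flexible S S') (phi : formula S)
  : formula S' :=
  match phi with
  | Var i => Var i
  | App n c args => @term_op S' (free S') n (h n c) (fun k => ext h (args k))
  end.

Definition star_obj (S S' : signature) (h : flexible S S') (M : structure S')
  : structure S := @Structure S M (fun n c args => @term_op S' M n (h n c) args).

Lemma homo_eval (S : signature) (M N : structure S) (f : homo M N)
  (phi : formula S) (v : forall i, occurs i phi -> M) :
  f (eval v) = eval (fun i oi => f (v i oi)).
Proof.
elim: phi v => [//|n c args IH] v /=.
by rewrite homoP; congr op; apply/funext => k; rewrite IH.
Qed.

Definition star_homo (S S' : signature) (h : flexible S S')
  (M N : structure S') (f : homo M N) : homo (star_obj h M) (star_obj h N).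
Proof.
refine (@Homo S (star_obj h M) (star_obj h N) (fun x => f x) _).
by move=> n c args; rewrite /= /term_op homo_eval.
Defined.

Definition star (S S' : signature) (h : flexible S S')
  : functor (Str S') (Str S).
Proof.
refine (@Functor (Str S') (Str S) (star_obj h) (@star_homo _ _ h) _ _).
- by move=> M; exact: homo_eq.
- by move=> *; exact: homo_eq.
Defined.

(** * Logics *)

Record logic := Logic {
  sig : signature;
  entails : set (formula sig) -> formula sig -> Prop;
  entails_refl : forall Gamma phi, Gamma phi -> entails Gamma phi;
  entails_mono : forall Gamma Delta phi,
    Gamma `<=` Delta -> entails Gamma phi -> entails Delta phi;
  entails_cut : forall Gamma Delta phi,
    (forall psi, Delta psi -> entails Gamma psi) ->
    entails Delta phi -> entails Gamma phi;
  entails_fin : forall Gamma phi, entails Gamma phi ->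
    exists Gamma0, [/\ finite_set Gamma0, Gamma0 `<=` Gamma
                     & entails Gamma0 phi];
  entails_subst : forall (sigma : nat -> formula sig) Gamma phi,
    entails Gamma phi -> entails (subst sigma @` Gamma) (subst sigma phi) }.

(** * Quasivarieties *)

Definition equation (S : signature) : Type := formula S * formula S.

Definition map_eq (S S' : signature) (f : formula S -> formula S')
  (e : equation S) : equation S' := (f e.1, f e.2).

Record quasi_identity (S : signature) := QuasiIdentity {
  premises : set (equation S);
  premises_fin : finite_set premises;
  conclusion : equation S }.

Definition satisfies (S : signature) (M : structure S) (q : quasi_identity S) :=
  forall v : nat -> M,
    (forall e, premises q e -> eval_total v e.1 = eval_total v e.2) ->
    eval_total v (conclusion q).1 = eval_total v (conclusion q).2.

Definition quasivariety (S : signature) (K : class S) :=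
  exists Q : set (quasi_identity S),
    forall M, K M <-> (forall q, Q q -> satisfies M q).

(** * Algebraizability *)

Definition consequence (S : signature) (K : class S)
  (Gamma : set (equation S)) (e : equation S) :=
  forall A, K A -> forall g : homo (free S) A,
    (forall e', Gamma e' -> g e'.1 = g e'.2) -> g e.1 = g e.2.

Definition consequences (S : signature) (K : class S)
  (Gamma Delta : set (equation S)) :=
  forall e, Delta e -> consequence K Gamma e.

Section Instances.
Variable S : signature.

(* The set tau(gamma) of equations; the variable p of tau is x_0. *)
Definition tau_at (tau : set (equation S)) (gamma : formula S)
  : set (equation S) := map_eq (subst (fun _ => gamma)) @` tau.

Definition tau_set (tau : set (equation S)) (Gamma : set (formula S))
  : set (equation S) := \bigcup_(gamma in Gamma) tau_at tau gamma.

(* The set Delta(phi, psi) of formulas; the variables p, q of Delta are x_0 and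
   x_1. *)
Definition Delta_at (Delta : set (formula S)) (phi psi : formula S)
  : set (formula S) := subst (fun i => if i == 0 then phi else psi) @` Delta.

End Instances.

(* [K] is an equivalent algebraic semantics for [l], as witnessed by [tau], a
   set of equations delta(p) = epsilon(p), and [Delta]. *)
Record eas_via (l : logic) (K : class (sig l))
  (tau : set (equation (sig l))) (Delta : set (formula (sig l))) : Prop := EasVia {
  tau_fin : finite_set tau;
  tau_vars : forall e, tau e ->
    vars e.1 `<=` [set i | i < 1] /\ vars e.2 `<=` [set i | i < 1];
  Delta_fin : finite_set Delta;
  Delta_vars : forall phi, Delta phi -> vars phi `<=` [set i | i < 2];
  entails_eas : forall Gamma phi,
    entails Gamma phi <-> consequences K (tau_set tau Gamma) (tau_at tau phi);
  eas_Delta : forall phi psi,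
    consequences K [set (phi, psi)] (tau_set tau (Delta_at Delta phi psi)) /\
    consequences K (tau_set tau (Delta_at Delta phi psi)) [set (phi, psi)] }.

Definition equivalent_algebraic_semantics (l : logic)
  (K : class (sig l)) := exists tau Delta, eas_via K tau Delta.

Definition algebraizing_pair (l : logic) (tau : set (equation (sig l)))
  (Delta : set (formula (sig l))) := exists K, eas_via K tau Delta.

Definition algebraizable (l : logic) :=
  exists K, @equivalent_algebraic_semantics l K.

Record algebraizable_logic := AlgebraizableLogic {
  alogic :> logic;
  alogicP : algebraizable alogic }.

(* "The" quasivariety that is an equivalent algebraic semantics of [l]: when [l]
   is algebraizable there is exactly one, by a theorem of Blok and Pigozzi. *)
Definition QV (l : logic) : class (sig l) :=
  epsilon (inhabits (fun _ => False))
    (fun K => quasivariety K /\ equivalent_algebraic_semantics K).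

Arguments QV : clear implicits.

Definition QVcat (a : algebraizable_logic) : category :=
  @full_subcategory (Str (sig a)) (QV a).

Definition QVincl (a : algebraizable_logic)
  : functor (QVcat a) (Str (sig a)) := @inclusion (Str (sig a)) (QV a).

(* The arrows of the category A_f. *)
Record Af_arrow (a a' : algebraizable_logic) := AfArrow {
  flex :> flexible (sig a) (sig a');
  flex_entails : forall Gamma psi,
    entails Gamma psi -> entails (ext flex @` Gamma) (ext flex psi);
  flex_pair : forall tau Delta,
    @algebraizing_pair a tau Delta ->
    @algebraizing_pair a' (map_eq (ext flex) @` tau) (ext flex @` Delta) }.

(* Main.v *)
Require Import Defs.
From Stdlib Require Import ClassicalEpsilon.
From mathcomp Require Import all_boot.
From mathcomp Require Import boolp classical_sets cardinality.

(** Two facts carry the proof.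

    First, an algebraizable logic determines its equational consequence: a
    set [E] of equations entails [e] over an equivalent algebraic semantics
    exactly when the formulas [Delta] of the equations in [E] entail, in the
    logic, the formulas [Delta] of [e] ([eas_consequence]).  The sets [Delta]
    of two algebraizations of the same logic are interderivable, because
    [Delta phi phi] consists of theorems and an algebra that identifies [phi]
    and [psi] does not tell [Delta phi phi] from [Delta phi psi]
    ([Delta_interderivable]).  Hence any two equivalent algebraic semantics
    have the same equational consequence ([eas_consequence_unique]).  Since the
    logic is finitary, so is this consequence; its quasi-identities therefore
    axiomatize a quasivariety that is again an equivalent algebraic semantics
    ([exists_quasivariety_eas]).  So [QV] is what its name says ([QV_spec]).

    Second, evaluating [phi] in [star_obj h M] is evaluating [ext h phi] in
    [M] ([eval_total_star]).  A quasi-identity of [QV a] thus holds in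
    [star_obj h M] as soon as its translation by [ext h] holds in [M], and it
    remains to see that these translations hold in [QV a']
    ([QV_consequence_ext]): express the quasi-identity in the logic [a] through
    [Delta], translate the resulting entailments by [h], and read them back as
    equations through [ext h @` Delta], which belongs to an algebraizing pair
    of [a'] because [h] preserves such pairs.  The semantics that witnesses
    this pair may differ from [QV a']; the uniqueness of the equational
    consequence bridges the two. *)

Set Implicit Arguments.
Unset Strict Implicit.
Unset Printing Implicit Defensive.

Local Open Scope classical_set_scope.

(** * Homomorphisms from the free algebra *)

Definition lift_homo (S : signature) (M : structure S) (v : nat -> M)
  : homo (free S) M :=
  @Homo S (free S) M (eval_total v) (fun n c args => erefl).

Lemma homo_subst (S : signature) (M : structure S) (g : homo (free S) M)
  (sigma : nat -> formula S) (phi : formula S) :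
  g (subst sigma phi) = eval_total (fun i => g (sigma i)) phi.
Proof. exact: homo_eval. Qed.

Lemma subst_Var (S : signature) (phi : formula S) : subst Var phi = phi.
Proof.
by elim: phi => [//|n c args IH]; congr App; apply/funext => k; exact: IH.
Qed.

Lemma homo_free (S : signature) (M : structure S) (g : homo (free S) M)
  (phi : formula S) : g phi = eval_total (fun i => g (Var i)) phi.
Proof. by rewrite -[in LHS](subst_Var phi) homo_subst. Qed.

(** The valid quasi-identities of a class are its finitary consequences; the
    class used here is the singleton of [M]. *)
Lemma satisfies_consequence (S : signature) (M : structure S)
  (q : quasi_identity S) :
  satisfies M q <-> consequence (eq M) (premises q) (conclusion q).
Proof.
split=> [Mq _ <- g gq|Mq v].
  rewrite !homo_free; apply: Mq => e qe.
  by rewrite -!homo_free; exact: gq.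
exact: (Mq _ erefl (lift_homo v)).
Qed.

Definition holds (S : signature) (M : structure S) (g : homo (free S) M)
  (E : set (equation S)) := forall e, E e -> g e.1 = g e.2.

Lemma holds_tau_at (S : signature) (M : structure S) (g : homo (free S) M)
  (tau : set (equation S)) (phi psi : formula S) :
  g phi = g psi -> holds g (tau_at tau phi) -> holds g (tau_at tau psi).
Proof.
move=> gE gphi _ [t taut <-].
have := gphi (map_eq (subst (fun _ => phi)) t).
by rewrite /= !homo_subst gE; apply; exists t.
Qed.

Lemma holds_tau_set (S : signature) (M : structure S) (g : homo (free S) M)
  (tau : set (equation S)) (Gamma : set (formula S)) :
  holds g (tau_set tau Gamma) <->
  (forall gamma, Gamma gamma -> holds g (tau_at tau gamma)).
Proof.
split=> [gG gamma Ggamma e te|gG e [gamma Ggamma te]].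
  by apply: gG; exists gamma.
exact: (gG gamma).
Qed.

(** * Equational consequence of an algebraizable logic *)

Definition Delta_set (S : signature) (Delta : set (formula S))
  (E : set (equation S)) : set (formula S) :=
  \bigcup_(e in E) Delta_at Delta e.1 e.2.

Section EquivalentAlgebraicSemantics.
Variables (l : logic) (K : class (sig l)).
Variables (tau : set (equation (sig l))) (Delta : set (formula (sig l))).
Hypothesis KtD : eas_via K tau Delta.

Lemma eas_entails Gamma phi : entails Gamma phi <->
  (forall A, K A -> forall g : homo (free (sig l)) A,
     holds g (tau_set tau Gamma) -> holds g (tau_at tau phi)).
Proof.
rewrite (entails_eas KtD).
by split=> H; [move=> A KA g gG e /H; apply | move=> e te A KA g /H; apply].
Qed.

Lemma eas_homo_eq A (KA : K A) (g : homo (free (sig l)) A) phi psi :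
  g phi = g psi <-> holds g (tau_set tau (Delta_at Delta phi psi)).
Proof.
have [Dl Dr] := eas_Delta KtD phi psi; split=> [gE e te|gD].
  by apply: (Dl e te A KA g) => _ ->.
exact: (Dr (phi, psi) erefl A KA g).
Qed.

Lemma entails_Delta_diag phi delta :
  Delta_at Delta phi phi delta -> entails set0 delta.
Proof.
move=> Dd; apply/eas_entails => A KA g _.
exact: ((holds_tau_set _ _ _).1 ((eas_homo_eq KA g phi phi).1 erefl)).
Qed.

Lemma eas_consequence E e : consequence K E e <->
  (forall delta, Delta_at Delta e.1 e.2 delta ->
     entails (Delta_set Delta E) delta).
Proof.
have holdsE A (KA : K A) (g : homo (free (sig l)) A) :
    holds g (tau_set tau (Delta_set Delta E)) <-> holds g E.
  rewrite holds_tau_set; split=> [gD e' Ee'|gE delta [e' Ee' Dd]].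
    apply/(eas_homo_eq KA)/holds_tau_set => delta Dd.
    by apply: gD; exists e'.
  by apply: (holds_tau_set _ _ _).1 Dd; apply/(eas_homo_eq KA); exact: gE.
split=> [Ee delta Dd|ED A KA g gE].
  apply/eas_entails => A KA g /(holdsE _ KA) gE.
  by apply: (holds_tau_set _ _ _).1 Dd; apply/(eas_homo_eq KA); exact: Ee.
apply/(eas_homo_eq KA)/holds_tau_set => delta /ED /eas_entails; apply=> //.
exact/(holdsE _ KA).
Qed.

(** Finitarity of the logic passes to the equational consequence because
    [Delta] is finite: each of the finitely many formulas that express [e]
    follows from finitely many formulas, each of which comes from one equation
    of [E]. *)
Lemma eas_consequence_fin E e : consequence K E e ->
  exists E0, [/\ finite_set E0, E0 `<=` E & consequence K E0 e].
Proof.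
move=> /eas_consequence ED.
pose at_e d := subst (fun i => if i == 0 then e.1 else e.2) d.
have fin_d d : exists E0, Delta d ->
    [/\ finite_set E0, E0 `<=` E & entails (Delta_set Delta E0) (at_e d)].
  have [Dd|nDd] := pselect (Delta d); last by exists set0.
  have [|G [finG GE Gd]] := @entails_fin l (Delta_set Delta E) (at_e d).
    by apply: ED; exists d.
  have /choice[f fP] gamma : exists e',
      G gamma -> E e' /\ Delta_at Delta e'.1 e'.2 gamma.
    have [/GE [e' Ee' De']|nG] := pselect (G gamma); first by exists e'.
    by exists e.
  exists (f @` G) => _; split.
  - exact: finite_image.
  - by move=> _ [gamma /fP[Ef _] <-].
  - apply: entails_mono Gd => gamma Ggamma.
    by exists (f gamma); [exists gamma | have [] := fP _ Ggamma].
have [F FP] := choice fin_d.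
exists (\bigcup_(d in Delta) F d); split.
- by apply: bigcup_finite => [|d /FP[]//]; exact: Delta_fin KtD.
- by move=> e' [d /FP[_ FE _]] /FE.
- apply/eas_consequence => _ [d Dd <-]; have [_ _] := FP d Dd.
  apply: entails_mono => gamma [e' Fe' De'].
  by exists e' => //; exists d.
Qed.

End EquivalentAlgebraicSemantics.

(** An algebra of [K1] in which [Delta1 phi psi] is designated identifies [phi]
    and [psi]; there the formulas [Delta2 phi psi] take the same values as
    [Delta2 phi phi], which are theorems. *)
Lemma Delta_interderivable (l : logic) (K1 K2 : class (sig l))
  tau1 tau2 Delta1 Delta2 :
  eas_via K1 tau1 Delta1 -> eas_via K2 tau2 Delta2 ->
  forall phi psi delta, Delta_at Delta2 phi psi delta ->
    entails (Delta_at Delta1 phi psi) delta.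
Proof.
move=> eas1 eas2 phi psi _ [d Dd <-].
apply/(eas_entails eas1) => A KA g /(eas_homo_eq eas1 KA) gE.
pose delta := subst (fun i => if i == 0 then phi else phi) d.
have /(eas_entails eas1) thm : entails set0 delta.
  by apply: (entails_Delta_diag eas2 (phi := phi)); exists d.
apply: (@holds_tau_at _ _ g tau1 delta); last first.
  by apply: thm => //; apply/holds_tau_set.
rewrite /delta !homo_subst; congr eval_total.
by apply/funext => i; case: (i == 0).
Qed.

Lemma eas_consequence_unique (l : logic) (K1 K2 : class (sig l)) :
  equivalent_algebraic_semantics K1 -> equivalent_algebraic_semantics K2 ->
  forall E e, consequence K1 E e -> consequence K2 E e.
Proof.
move=> [tau1 [D1 eas1]] [tau2 [D2 eas2]] E e /(eas_consequence eas1) ED.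
apply/(eas_consequence eas2) => delta.
move=> /(Delta_interderivable eas1 eas2); apply: entails_cut => d1 /ED.
apply: entails_cut => gamma [e' Ee' /(Delta_interderivable eas2 eas1)].
by apply: entails_mono => d2 Dd2; exists e'.
Qed.

(** * The equivalent quasivariety semantics *)

(** The quasi-identities valid in an equivalent algebraic semantics [K] define
    a class that contains [K] and, by finitarity, has no fewer equational
    consequences. *)
Lemma exists_quasivariety_eas (l : logic) : algebraizable l ->
  exists K, quasivariety K /\ @equivalent_algebraic_semantics l K.
Proof.
case=> K [tau [Delta eas]].
pose Q : set (quasi_identity (sig l)) :=
  [set q | consequence K (premises q) (conclusion q)].
pose KQ : class (sig l) := fun M => forall q, Q q -> satisfies M q.
have KQE E e : consequence KQ E e <-> consequence K E e.
  split=> [Ee A KA|/(eas_consequence_fin eas)[E0 [finE0 E0E E0e]] A KQA g gE].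
    apply: Ee => q Qq; apply/satisfies_consequence => _ <-; exact: Qq.
  have /satisfies_consequence := KQA (QuasiIdentity finE0 e) E0e.
  by apply=> // e' /E0E; exact: gE.
have KQsE E E' : consequences KQ E E' <-> consequences K E E'.
  by split=> EE' e /EE' /KQE.
exists KQ; split; first by exists Q.
exists tau, Delta; case: eas => ft tv fD Dv He HD; split=> //.
- by move=> Gamma phi; rewrite He; split=> /KQsE.
- by move=> phi psi; have [? ?] := HD phi psi; split; apply/KQsE.
Qed.

(** Without the existence just proved, [QV a] would be an arbitrary class. *)
Lemma QV_spec (a : algebraizable_logic) :
  quasivariety (QV a) /\ equivalent_algebraic_semantics (QV a).
Proof. exact: (epsilon_spec _ _ (exists_quasivariety_eas (alogicP a))). Qed.

(** * Translation along a flexible morphism *)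

Lemma eval_total_star (S S' : signature) (h : flexible S S')
  (M : structure S') (v : nat -> M) (phi : formula S) :
  @eval_total S (star_obj h M) v phi = eval_total v (ext h phi).
Proof.
elim: phi => [//|n c args IH].
have argsE : (fun k => @eval_total S (star_obj h M) v (args k)) =
    (fun k => eval_total v (ext h (args k))) by apply/funext.
transitivity (@term_op _ M _ (h n c) (fun k => eval_total v (ext h (args k)))).
  by rewrite -argsE.
exact/esym/(homo_eval (lift_homo v)).
Qed.

Lemma ext_subst (S S' : signature) (h : flexible S S')
  (sigma : nat -> formula S) (phi : formula S) :
  ext h (subst sigma phi) = subst (fun i => ext h (sigma i)) (ext h phi).
Proof.
(* [ext h] is a homomorphism to the [h]-reduct of the free algebra *)
pose g : homo (free S) (star_obj h (free S')) :=
  @Homo S (free S) (star_obj h (free S')) (ext h) (fun n c args => erefl).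
by rewrite [LHS](homo_subst g) eval_total_star.
Qed.

Lemma ext_Delta_at (S S' : signature) (h : flexible S S')
  (Delta : set (formula S)) (phi psi : formula S) :
  ext h @` Delta_at Delta phi psi =
  Delta_at (ext h @` Delta) (ext h phi) (ext h psi).
Proof.
rewrite /Delta_at !image_comp; apply: eq_imagel => d _ /=.
by rewrite ext_subst; congr subst; apply/funext => i; case: (i == 0).
Qed.

(** The pair [(tau, Delta)] of [a] is carried by [h] to an algebraizing pair of
    [a'], so that the [Delta]-form of the consequence, once translated, is again
    the form given by [eas_consequence], for some semantics [K] of [a']. *)
Lemma QV_consequence_ext (a a' : algebraizable_logic) (h : Af_arrow a a') E e :
  consequence (QV a) E e ->
  consequence (QV a') (map_eq (ext h) @` E) (map_eq (ext h) e).
Proof.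
have [_ [tau [Delta eas]]] := QV_spec a.
have [K eas'] : algebraizing_pair (map_eq (ext h) @` tau) (ext h @` Delta).
  by apply: flex_pair; exists (QV a).
move=> /(eas_consequence eas) ED.
apply: (@eas_consequence_unique _ K); [by do 2 eexists; exact: eas'| |].
  by have [] := QV_spec a'.
apply/(eas_consequence eas') => delta'.
rewrite -[X in X delta']ext_Delta_at => -[delta /ED /(flex_entails h)].
move=> + <-; apply: entails_mono => _ [gamma [e' Ee' De'] <-].
exists (map_eq (ext h) e'); first by exists e'.
by rewrite -ext_Delta_at; exists gamma.
Qed.

Lemma QV_star (a a' : algebraizable_logic) (h : Af_arrow a a')
  (M : structure (sig a')) : QV a' M -> QV a (star_obj h M).
Proof.
move=> QVM; have [[Q QVE] _] := QV_spec a.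
apply/QVE => q Qq v; rewrite !eval_total_star => vq.
have qE : consequence (QV a) (premises q) (conclusion q).
  by move=> A /QVE /(_ q Qq) /satisfies_consequence; apply.
apply: (QV_consequence_ext qE QVM (g := @lift_homo _ M v)) => _ [e qe <-] /=.
by rewrite -!eval_total_star; exact: vq.
Qed.

(** * The restricted functor *)

Lemma functor_eq (C D : category) (o : C -> D)
  (m : forall A B : C, arrow A B -> arrow (o A) (o B)) i1 i2 c1 c2 :
  @Functor C D o m i1 c1 = @Functor C D o m i2 c2.
Proof. by congr Functor; exact: Prop_irrelevance. Qed.

Theorem proposition3p8 (a a' : algebraizable_logic) (h : Af_arrow a a') :
  exists hres : functor (QVcat a') (QVcat a),
    functor_comp (QVincl a) hres = functor_comp (star h) (QVincl a').
Proof.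
unshelve eexists.
  refine (@Functor (QVcat a') (QVcat a)
    (fun M => exist _ (star_obj h (sval M)) (QV_star h (svalP M)))
    (fun M N f => star_homo h f) _ _).
  - by move=> M; exact: (@fmap_id _ _ (star h)).
  - by move=> M N P g f; exact: (@fmap_comp _ _ (star h)).
exact: functor_eq.
Qed.
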